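(* Let $p$ be an odd prime, let $T_p=\bigcup_{n\ge 1}\{\xi\in\mathbb{C}_p:\xi^{p^n}=1\}$ and $q\in T_p$. Then for every $n\in\mathbb{Z}_+=\{0,1,2,\dots\}$, \[ \frac{1}{2^n}\int_{\mathbb{Z}_p}\int_{\mathbb{Z}_p}q^{x+y}(x+y)^{n}\,d\mu_{-1}(x)\,d\mu(y)=B_n(q^2), \] where $B_n(q^2)$ is the $q$-Bernoulli number with parameter $q^2$.
   Context: For a uniformly differentiable function $f:\mathbb{Z}_p\to\mathbb{C}_p$, the bosonic $p$-adic invariant integral is $\int_{\mathbb{Z}_p}f(y)\,d\mu(y)=\lim_{N\to\infty}\frac{1}{p^N}\sum_{y=0}^{p^N-1}f(y)$ and the fermionic $p$-adic integral is $\int_{\mathbb{Z}_p}f(x)\,d\mu_{-1}(x)=\lim_{N\to\infty}\sum_{x=0}^{p^N-1}f(x)(-1)^x$. For $q\in T_p$ a $p^m$-th root of unity, $q^x$ for $x\in\mathbb{Z}_p$ means $q^{x'}$ with $x'\in\mathbb{Z}$, $x'\equiv x \pmod{p^m}$. For a parameter $Q$, the $q$-Bernoulli numbers $B_n(Q)$ are defined by $\frac{t}{Qe^t-1}=\sum_{n\ge0}B_n(Q)\frac{t^n}{n!}$; thus $B_n(q^2)$ is defined by $\frac{t}{q^2e^t-1}=\sum_{n\ge0}B_n(q^2)\frac{t^n}{n!}$. *)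

(* Defs.v *)
From HB Require Import structures.
From mathcomp Require Import all_boot all_order all_algebra.
From mathcomp Require Import all_classical all_reals.
From mathcomp Require Import topology normedtype sequences.

Set Implicit Arguments.
Unset Strict Implicit.
Unset Printing Implicit Defensive.

Import Order.TTheory GRing.Theory Num.Theory.
Local Open Scope classical_set_scope.
Local Open Scope ring_scope.

(* normedZmodType cannot be used for the absolute value: its axiom normrMn,
   `|x *+ n| = `|x| *+ n, fails for p-adic absolute values. *)
Record ultrametricField (R : realType) := UltrametricField {
  uf_field : closedFieldType ;
  uf_abs : uf_field -> R ;
  uf_abs_ge0 : forall x, 0 <= uf_abs x ;
  uf_abs_eq0 : forall x, uf_abs x = 0 <-> x = 0 ;
  uf_absM : forall x y, uf_abs (x * y) = uf_abs x * uf_abs y ;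
  uf_absD : forall x y, uf_abs (x + y) <= Num.max (uf_abs x) (uf_abs y)
}.

Definition uf_sort (R : realType) (K : ultrametricField R) : Type := uf_field K.
Coercion uf_sort : ultrametricField >-> Sortclass.

HB.instance Definition _ (R : realType) (K : ultrametricField R) :=
  GRing.ClosedField.copy (uf_sort K) (uf_field K).

Definition pabs (R : realType) (K : ultrametricField R) : K -> R :=
  @uf_abs R K.

Section UltrametricTopology.
Context {R : realType} {K : ultrametricField R}.
Implicit Types x y z : K.

Lemma pabs_ge0 x : 0 <= pabs x. Proof. exact: uf_abs_ge0. Qed.

Lemma pabs_eq0 x : pabs x = 0 <-> x = 0. Proof. exact: uf_abs_eq0. Qed.

Lemma pabsM x y : pabs (x * y) = pabs x * pabs y. Proof. exact: uf_absM. Qed.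

Lemma pabsD x y : pabs (x + y) <= Num.max (pabs x) (pabs y).
Proof. exact: uf_absD. Qed.

Lemma pabs0 : pabs (0 : K) = 0. Proof. exact/pabs_eq0. Qed.

Lemma pabs1 : pabs (1 : K) = 1.
Proof.
have nz : pabs (1 : K) != 0 by apply/eqP => /pabs_eq0/eqP; rewrite oner_eq0.
by apply: (mulfI nz); rewrite -pabsM !mulr1.
Qed.

Lemma pabsN x : pabs (- x) = pabs x.
Proof.
suff N1 : pabs (-1 : K) = 1 by rewrite -mulN1r pabsM N1 mul1r.
by apply: (@pexpIrn _ 2) => //; rewrite ?nnegrE ?pabs_ge0 ?ler01 //
  expr1n expr2 -pabsM mulrNN mulr1 pabs1.
Qed.

Definition pdist x y : R := pabs (x - y).

Lemma pdistxx x : pdist x x = 0. Proof. by rewrite /pdist subrr pabs0. Qed.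

Lemma pdist_positivity x y : pdist x y = 0 -> x = y.
Proof. by move=> /pabs_eq0/eqP; rewrite subr_eq0 => /eqP. Qed.

Lemma pdist_sym x y : pdist x y = pdist y x.
Proof. by rewrite /pdist -pabsN opprB. Qed.

Lemma pdist_triangle y x z : pdist x z <= pdist x y + pdist y z.
Proof.
rewrite /pdist -[x - z](subrKA y) (le_trans (pabsD _ _))//.
by rewrite ge_max lerDl lerDr !pabs_ge0.
Qed.

End UltrametricTopology.

HB.instance Definition _ (R : realType) (K : ultrametricField R) :=
  isPointed.Build (uf_sort K) 0.
HB.instance Definition _ (R : realType) (K : ultrametricField R) :=
  isMetric.Build R (uf_sort K) pdistxx pdist_positivity pdist_sym
    pdist_triangle.

Definition algebraic_over (F : fieldType) (k : set F) : set F :=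
  [set x | exists P : {poly F},
    [/\ P != 0, (forall i, k P`_i) & root P x]].

(* K is C_p, the completion of an algebraic closure of Q_p.  As K is complete
   and |p| = 1/p, the closure of the prime field of K is Q_p.  These properties
   determine K up to isometric isomorphism. *)
Record is_padic_complex (p : nat) (R : realType) (K : ultrametricField R) :
    Prop := IsPadicComplex {
  padic_abs_p : pabs (p%:R : K) = p%:R^-1 ;
  padic_complete :
    forall F : set_system K, ProperFilter F -> cauchy F -> cvg F ;
  padic_algebraic_dense :
    closure (algebraic_over (closure (range (ratr : rat -> K)))) = [set: K]
}.

Section PadicIntegers.
Context {R : realType} {K : ultrametricField R}.
Implicit Types x y : K.

Definition padicZ : set K := closure (range (fun z : int => z%:~R : K)).

Lemma padicZP x :
  padicZ x <-> forall e : R, 0 < e -> exists z : int, pabs (x - z%:~R) < e.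
Proof.
split=> [Zx e e0|Zx A /nbhs_ballP[e /= e0 eA]].
  have [_ [[z _ <-]]] := Zx _ (nbhsx_ballx x e e0).
  by rewrite ballEmdist; exists z.
have [z xz] := Zx _ e0.
by exists z%:~R; split; [exists z|apply: eA; rewrite ballEmdist].
Qed.

Lemma pabs_int (z : int) : pabs (z%:~R : K) <= 1.
Proof.
have nat1 n : pabs (n%:R : K) <= 1.
  elim: n => [|n IH]; first by rewrite pabs0.
  by rewrite -natr1 (le_trans (pabsD _ _))// ge_max IH pabs1 lexx.
by case: z => n; rewrite ?NegzE ?mulrNz ?pabsN -pmulrn.
Qed.

Definition padicZ_pred : {pred K} := [pred x | x \in padicZ].

Lemma padicZ_subring : subring_closed padicZ_pred.
Proof.
split=> [|x y|x y]; rewrite !inE /= ?inE.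
- by apply/padicZP => e e0; exists 1; rewrite subrr pabs0.
- move=> /padicZP Zx /padicZP Zy; apply/padicZP => e e0.
  have [a xa] := Zx _ e0; have [b yb] := Zy _ e0.
  exists (a - b); rewrite rmorphB /=.
  rewrite [X in pabs X](_ : _ = (x - a%:~R) - (y - b%:~R)); last first.
    by rewrite !opprD !opprK addrACA.
  by rewrite (le_lt_trans (pabsD _ _))// pabsN gt_max xa.
- move=> /padicZP Zx /padicZP Zy; apply/padicZP => e e0.
  have e1 : 0 < Num.min e 1 by rewrite lt_min e0 ltr01.
  have [a xa] := Zx _ e1; have [b yb] := Zy _ e1.
  move: xa yb; rewrite !lt_min => /andP[xa _] /andP[yb yb1].
  exists (a * b).
  rewrite [X in pabs X](_ : _ = (x - a%:~R) * y + a%:~R * (y - b%:~R));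
    last by rewrite rmorphM /= mulrBl mulrBr addrA subrK.
  have y1 : pabs y <= 1.
    rewrite -(subrK b%:~R y) (le_trans (pabsD _ _))// ge_max.
    by rewrite (ltW yb1) pabs_int.
  rewrite (le_lt_trans (pabsD _ _))// gt_max !pabsM.
  rewrite (le_lt_trans (ler_wpM2l (pabs_ge0 _) y1)) ?mulr1//=.
  by rewrite (le_lt_trans (ler_wpM2r (pabs_ge0 _) (pabs_int a))) ?mul1r.
Qed.

HB.instance Definition _ :=
  GRing.isSubringClosed.Build K padicZ_pred padicZ_subring.

End PadicIntegers.
Arguments padicZ_pred {R} K.

(* Z_p, the closure of the integers in C_p, as a ring. *)
Record padicInt (R : realType) (K : ultrametricField R) := PadicInt {
  padicInt_val :> K ;
  padicInt_valP : padicInt_val \in padicZ_pred K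
}.

HB.instance Definition _ (R : realType) (K : ultrametricField R) :=
  [isSub for @padicInt_val R K].
HB.instance Definition _ (R : realType) (K : ultrametricField R) :=
  [Choice of padicInt K by <:].
HB.instance Definition _ (R : realType) (K : ultrametricField R) :=
  [SubChoice_isSubComNzRing of padicInt K by <:].

Section Integrals.
Variables (p : nat) (R : realType) (K : ultrametricField R).
Implicit Types (f : padicInt K -> K) (q : K).

Definition bosonic_sum f (N : nat) : K :=
  ((p ^ N)%:R)^-1 * \sum_(y < p ^ N) f y%:R.

Definition fermionic_sum f (N : nat) : K :=
  \sum_(x < p ^ N) f x%:R * (-1) ^+ x.

Definition bosonic_integrable f : Prop := cvg (bosonic_sum f @ \oo).
Definition bosonic_integral f : K := lim (bosonic_sum f @ \oo).

Definition fermionic_integrable f : Prop := cvg (fermionic_sum f @ \oo).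
Definition fermionic_integral f : K := lim (fermionic_sum f @ \oo).

Definition Tp : set K :=
  [set q | exists2 n : nat, (1 <= n)%N & q ^+ (p ^ n) = 1].

Definition padic_exponents q (x : padicInt K) : set int :=
  [set z | exists2 m : nat, q ^+ (p ^ m) = 1 &
    exists u : padicInt K, x - z%:~R = p%:R ^+ m * u].

(* q ^ z is the same for all z in padic_exponents q x, and for p prime, K = C_p
   and q in Tp this set is nonempty. *)
Definition padic_pow q (x : padicInt K) : K :=
  q ^ xget 0 (padic_exponents q x).

End Integrals.

(* Formal power series in t are represented by their coefficient sequences. *)
Section QBernoulli.
Variable F : fieldType.
Implicit Types a b : nat -> F.

Definition fps_mul a b : nat -> F :=
  fun n => \sum_(i < n.+1) a i * b (n - i)%N.

(* The quotient a / b, unique for b <> 0 as F[[t]] is a domain, and 0 if b does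
   not divide a.  Division is needed for b without constant term: for Q = 1,
   t / (Q e^t - 1) is a power series although Q e^t - 1 is not invertible. *)
Definition fps_div a b : nat -> F :=
  xget (fun=> 0) [set c | fps_mul b c = a].

Definition fps_one : nat -> F := fun n => (n == 0%N)%:R.
Definition fps_t : nat -> F := fun n => (n == 1%N)%:R.
Definition fps_exp : nat -> F := fun n => (n`!%:R)^-1.

Definition qBernoulli (Q : F) (n : nat) : F :=
  n`!%:R * fps_div fps_t (fun k => Q * fps_exp k - fps_one k) n.

End QBernoulli.

(* Main.v *)
Require Import Defs.
From HB Require Import structures.
From mathcomp Require Import all_boot all_order all_algebra.
From mathcomp Require Import all_classical all_reals.
From mathcomp Require Import topology normedtype sequences.
From mathcomp Require Import ring.

Set Implicit Arguments.
Unset Strict Implicit.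
Unset Printing Implicit Defensive.

Import Order.TTheory GRing.Theory Num.Theory.
Import numFieldNormedType.Exports.
Local Open Scope classical_set_scope.
Local Open Scope ring_scope.

(** Write [g n z = q^z z^n] and let [G n y] be the fermionic integral of
    [x |-> g n (x + y)].  Telescoping the alternating sums gives
    [G n (y + 1) + G n y = 2 g n y], hence
    [G n (y + 2) - G n y = 2 g n (y + 1) - 2 g n y], while expanding
    [(x + y + 2)^n] gives [G n (y + 2) = q^2 \sum_j C(n, j) 2^(n-j) G j y].
    Summing over [y < p^N] and dividing by [p^N], the bosonic sums [T n] of
    [G n] satisfy, as soon as [q^(p^N) = 1],
    [q^2 \sum_j C(n, j) 2^(n-j) T j - T n = 2 (p^(N n) - 0^n) / p^N],
    whose right-hand side tends to [2] for [n = 1] and to [0] otherwise.  In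
    terms of the power series with coefficients [T n / (2^n n!)], the left-hand
    side is multiplication by [q^2 e^t - 1], a nonzero series: solving this
    triangular system (from the order of the series on, to include [q = 1])
    gives the convergence of the [T n], and in the limit the equation that
    defines the numbers [B_n(q^2)].  The same argument with [q e^t + 1] gives the
    convergence of the fermionic sums. *)

(** * Products of formal power series *)

Section PowerSeries.
Variable F : fieldType.
Implicit Types b c : nat -> F.

Lemma fps_mul_rev b c n :
  fps_mul b c n = \sum_(j < n.+1) b (n - j)%N * c j.
Proof.
rewrite /fps_mul (reindex_inj rev_ord_inj)/=; apply: eq_bigr => j _.
by rewrite subSS subKn // -ltnS.
Qed.

(** For [j > k] the factor [b (k + s - j)] has index below [s] and vanishes. Multiplication by [b]
    is thus a triangular system in [c] with diagonal entry [b s]. *)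
Lemma fps_mul_order b c s k : (forall i, (i < s)%N -> b i = 0) ->
  fps_mul b c (k + s)
  = b s * c k + \sum_(j < k) b (k + s - j)%N * c j.
Proof.
move=> b0; rewrite fps_mul_rev -(big_mkord xpredT
  (fun j => b (k + s - j)%N * c j)) -addnS.
rewrite (big_cat_nat (n := k)) ?leq_addr//= big_mkord addrC; congr (_ + _).
rewrite addnS big_ltn ?ltnS ?leq_addr// addKn big_nat big1 ?addr0// => j.
case/andP=> kj js; rewrite b0 ?mul0r//.
by rewrite ltn_subLR ?ltn_add2r// -ltnS.
Qed.

Lemma fps_mul_inj b s : b s != 0 -> (forall i, (i < s)%N -> b i = 0) ->
  injective (fps_mul b).
Proof.
move=> bs b0 c d cd; apply/funext => k; elim/ltn_ind: k => k IH.
apply: (mulfI bs); have := congr1 (fun f => f (k + s)%N) cd.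
rewrite !(fps_mul_order _ _ b0); under eq_bigr => j _ do rewrite IH//.
exact: addIr.
Qed.

(** On exponential generating series, a product with [e^t] is a binomial convolution of
    coefficients. This turns the recurrences below into products with [q e^t + 1] and
    [q^2 e^t - 1]. *)
Lemma fps_mul_exp (a e : F) (u : nat -> F) n : n`!%:R != 0 :> F ->
  n`!%:R * fps_mul (fun k => a * fps_exp F k + e * fps_one F k)
                   (fun k => u k / k`!%:R) n
  = a * (\sum_(j < n.+1) 'C(n, j)%:R * u j) + e * u n.
Proof.
move=> n0; rewrite fps_mul_rev mulr_sumr.
under eq_bigr => j _ do rewrite mulrDl mulrDr.
rewrite big_split/= [X in _ + X](bigD1 ord_max)//= subnn [X in _ + (_ + X)]big1.
  rewrite addr0 /fps_one eqxx mulr1 mulr_sumr; congr (_ + _); last first.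
    by rewrite mulrCA [_ * (_ / _)]mulrCA divff// mulr1.
  apply: eq_bigr => j _; have jn : (j <= n)%N by rewrite -ltnS.
  (* As a factor of [n!], which is nonzero in [F], each of [j!] and [(n - j)!] is nonzero. *)
  move: n0; rewrite -(bin_fact jn) !natrM !mulf_eq0 !negb_or /fps_exp.
  case/and3P=> _ j0 nj0.
  by field; rewrite j0.
move=> j jn; rewrite /fps_one subn_eq0.
suff -> : (n <= j)%N = false by rewrite mulr0 mul0r mulr0.
apply/negbTE; rewrite -ltnNge ltn_neqAle -ltnS ltn_ord andbT.
by apply: contraNneq jn => jn; apply/eqP/val_inj.
Qed.

End PowerSeries.

(** * Limits of sequences in an ultrametric field *)

Section Ultrametric.
Context {R : realType} {K : ultrametricField R}.
Implicit Types (x y l : K) (u v : nat -> K).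

Lemma cvg_pabsP u l : u @ \oo --> l <->
  forall e : R, 0 < e -> \forall N \near \oo, pabs (l - u N) < e.
Proof.
by split=> [/cvg_ballP H e /H|H]; [|apply/cvg_ballP => e /H];
  rewrite ballEmdist.
Qed.

Lemma cvg_pabsD u v l l' : u @ \oo --> l -> v @ \oo --> l' ->
  (fun N => u N + v N) @ \oo --> l + l'.
Proof.
move=> /cvg_pabsP ul /cvg_pabsP vl; apply/cvg_pabsP => e e0.
near=> N; rewrite opprD addrACA (le_lt_trans (pabsD _ _))// gt_max.
by apply/andP; split; near: N; [exact: ul|exact: vl].
Unshelve. all: end_near. Qed.

Lemma cvg_pabsZ (a : K) u l : u @ \oo --> l ->
  (fun N => a * u N) @ \oo --> a * l.
Proof.
have [->|a0] := eqVneq a 0.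
  by move=> _; under eq_fun do rewrite mul0r; rewrite mul0r; exact: cvg_cst.
have pa : 0 < pabs a.
  rewrite lt_neqAle pabs_ge0 andbT eq_sym.
  by apply: contraNneq a0 => /pabs_eq0 ->.
move=> /cvg_pabsP ul; apply/cvg_pabsP => e e0.
near=> N; rewrite -mulrBr pabsM mulrC -ltr_pdivlMr//; near: N.
by apply: ul; rewrite divr_gt0.
Unshelve. all: end_near. Qed.

Lemma cvg_pabsM u v l l' : u @ \oo --> l -> v @ \oo --> l' ->
  (fun N => u N * v N) @ \oo --> l * l'.
Proof.
(* Since [u v = l v + l' u - l l' + (l - u) (l' - v)], only this product of null sequences goes
   beyond sums and scalings. *)
move=> ul vl; have H : (fun N => (l - u N) * (l' - v N)) @ \oo --> (0 : K).
  move/cvg_pabsP: ul => ul; move/cvg_pabsP: vl => vl.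
  apply/cvg_pabsP => e e0; near=> N.
  rewrite sub0r pabsN pabsM (@le_lt_trans _ _ (pabs (l - u N)))//.
    by rewrite ler_piMr ?pabs_ge0// ltW//; near: N; exact: vl.
  by near: N; exact: ul.
rewrite (_ : l * l' = l * l' + l' * l + - 1 * (l * l') + 0); last by ring.
rewrite (_ : (fun N => _) = fun N => l * v N + l' * u N + - 1 * (l * l')
    + (l - u N) * (l' - v N)); last by apply/funext => N; ring.
apply: cvg_pabsD H; apply: cvg_pabsD; last exact: cvg_cst.
by apply: cvg_pabsD; apply: cvg_pabsZ.
Unshelve. all: end_near. Qed.

Lemma cvg_pabsX u l n : u @ \oo --> l -> (fun N => u N ^+ n) @ \oo --> l ^+ n.
Proof.
move=> ul; elim: n => [|n IH].
  by under eq_fun do rewrite expr0; rewrite expr0; exact: cvg_cst.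
by under eq_fun do rewrite exprS; rewrite exprS; exact: cvg_pabsM.
Qed.

Lemma cvg_pabs_sum (I : Type) (r : seq I) (u : I -> nat -> K) (l : I -> K) :
  (forall i, u i @ \oo --> l i) ->
  (fun N => \sum_(i <- r) u i N) @ \oo --> \sum_(i <- r) l i.
Proof.
move=> ul; elim: r => [|i r IH].
  by under eq_fun do rewrite big_nil; rewrite big_nil; exact: cvg_cst.
under eq_fun do rewrite big_cons; rewrite big_cons; exact: cvg_pabsD.
Qed.

Lemma cvg_pabs_lim u l : u @ \oo --> l -> lim (u @ \oo) = l.
Proof. exact/cvg_lim/metric_hausdorff. Qed.

Lemma cvg_pabs_uniq u l l' : u @ \oo --> l -> u @ \oo --> l' -> l = l'.
Proof. by move=> /cvg_pabs_lim <- /cvg_pabs_lim. Qed.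

(** Solving the triangular system writes [u N k] through coefficient [k + s] of the product and the
    earlier [u N j], with coefficients independent of [N]. *)
Lemma is_cvg_fps_mul (b : nat -> K) s (u : nat -> nat -> K) :
  b s != 0 -> (forall i, (i < s)%N -> b i = 0) ->
  (forall k, cvg ((fun N => fps_mul b (u N) k) @ \oo)) ->
  forall k, cvg ((fun N => u N k) @ \oo).
Proof.
move=> bs b0 cb; elim/ltn_ind => k IH.
rewrite (_ : (fun N => u N k) = fun N => (b s)^-1 * (fps_mul b (u N) (k + s)
    + \sum_(j < k) - b (k + s - j)%N * u N j)); last first.
  apply/funext => N; rewrite (fps_mul_order _ _ b0).
  under [X in _ + X]eq_bigr => j _ do rewrite mulNr.
  by rewrite sumrN addrK mulKf.
apply: cvgP; apply: cvg_pabsZ; apply: cvg_pabsD; first exact: cb.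
apply: (@cvg_pabs_sum _ _ (fun (j : 'I_k) N => - b (k + s - j)%N * u N j)) => j.
by apply: cvg_pabsZ; apply: IH.
Qed.

End Ultrametric.

(** * Absolute values of integers, congruences in [Z_p] and powers of [q] *)

Section PadicIntegers.
Variables (p : nat) (R : realType) (K : ultrametricField R).
Hypothesis p_prime : prime p.
Hypothesis abs_p : pabs (p%:R : K) = p%:R^-1.
Implicit Types (q : K) (x y : padicInt K).

Lemma pabsX (a : K) n : pabs (a ^+ n) = pabs a ^+ n.
Proof. by elim: n => [|n IH]; rewrite ?pabs1// !exprS pabsM IH. Qed.

Lemma pabs_nat n : pabs (n%:R : K) <= 1.
Proof. by rewrite pmulrn pabs_int. Qed.

Lemma abs_p_gt0 : 0 < p%:R^-1 :> R.
Proof. by rewrite invr_gt0 ltr0n prime_gt0. Qed.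

Lemma abs_p_lt1 : p%:R^-1 < 1 :> R.
Proof. by rewrite invf_lt1 ?ltr0n ?prime_gt0// ltr1n prime_gt1. Qed.

(** Bezout gives [1 = k p - a n]; if [|n| < 1], both terms would have absolute value below 1. *)
Lemma pabs_coprime n : coprime p n -> pabs (n%:R : K) = 1.
Proof.
move=> pn; apply/eqP; rewrite eq_le pabs_nat leNgt; apply/negP => n1.
have [a _] := Bezoutl n (prime_gt0 p_prime).
rewrite (eqP pn) => /dvdnP[k ak].
have: pabs ((k * p)%:R - (a * n)%:R : K) < 1.
  rewrite (le_lt_trans (pabsD _ _))// pabsN gt_max !natrM !pabsM abs_p.
  rewrite (le_lt_trans (ler_wpM2r (ltW abs_p_gt0) (pabs_nat k))) ?mul1r.
    by rewrite (le_lt_trans (ler_wpM2r (pabs_ge0 _) (pabs_nat a))) ?mul1r.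
  exact: abs_p_lt1.
by rewrite -ak natrD addrK pabs1 ltxx.
Qed.

(** A prime characteristic [r] would have [|r| = 0], whereas [|r|] is [1/p] if [r = p] and 1
    otherwise. *)
Lemma natr_neq0 n : (0 < n)%N -> n%:R != 0 :> K.
Proof.
move=> n0; apply/negP => /(natf0_pchar n0)[r /andP[r_prime /eqP r0]].
have [pr|pr] := eqVneq p r.
  by have := abs_p_gt0; rewrite -abs_p pr r0 pabs0 ltxx.
have: coprime p r by rewrite prime_coprime// dvdn_prime2.
by move=> /pabs_coprime; rewrite r0 pabs0 => /eqP; rewrite eq_sym oner_eq0.
Qed.

Lemma pabs_le_dvdn m n : pabs (n%:R : K) <= p%:R^-1 ^+ m -> (p ^ m %| n)%N.
Proof.
elim: m n => [|m IH] n; first by rewrite expn0 dvd1n.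
move=> nm; have /IH/dvdnP[k nk] : pabs (n%:R : K) <= p%:R^-1 ^+ m.
  rewrite (le_trans nm)// exprS ger_pMl ?exprn_gt0 ?abs_p_gt0//.
  by rewrite ltW ?abs_p_lt1.
move: nm; rewrite nk natrM natrX pabsM pabsX abs_p exprS.
rewrite ler_pM2r ?exprn_gt0 ?abs_p_gt0// => kp.
rewrite expnS dvdn_mul//; apply: contraTT kp => pk.
by rewrite -ltNge pabs_coprime ?abs_p_lt1// prime_coprime.
Qed.

Lemma pabs_absz (z : int) : pabs (z%:~R : K) = pabs (`|z|%N%:R : K).
Proof. by case: (intP z) => // n; rewrite mulrNz pabsN abszN. Qed.

Lemma padicInt_valD x y :
  padicInt_val (x + y) = padicInt_val x + padicInt_val y.
Proof. exact: (rmorphD (val : padicInt K -> K)). Qed.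

Lemma padicInt_valB x y :
  padicInt_val (x - y) = padicInt_val x - padicInt_val y.
Proof. exact: (rmorphB (val : padicInt K -> K)). Qed.

Lemma padicInt_valM x y :
  padicInt_val (x * y) = padicInt_val x * padicInt_val y.
Proof. exact: (rmorphM (val : padicInt K -> K)). Qed.

Lemma padicInt_valX x n : padicInt_val (x ^+ n) = padicInt_val x ^+ n.
Proof. by elim: n => [|n IH]; rewrite ?expr0// !exprS padicInt_valM IH. Qed.

Lemma padicInt_val_nat n : padicInt_val n%:R = n%:R :> K.
Proof. exact: (rmorph_nat (val : padicInt K -> K)). Qed.

Lemma padicInt_val_int (z : int) : padicInt_val z%:~R = z%:~R :> K.
Proof. exact: (rmorph_int (val : padicInt K -> K)). Qed.

Lemma pabs_padicInt x : pabs (x : K) <= 1.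
Proof.
have /padicZP/(_ 1 ltr01)[z xz] : padicZ (x : K).
  by have := padicInt_valP x; rewrite !inE.
rewrite -(subrK z%:~R (x : K)) (le_trans (pabsD _ _))// ge_max (ltW xz).
exact: pabs_int.
Qed.

(** The quotient [(x - z) / p^m] is a limit of the integers [(w - z) / p^m], for integers [w]
    approaching [x]. *)
Lemma padicInt_quotient m x (z : int) :
  pabs (padicInt_val x - z%:~R) <= p%:R^-1 ^+ m ->
  exists u : padicInt K, x - z%:~R = p%:R ^+ m * u.
Proof.
move=> xz; set P : K := p%:R ^+ m.
have P0 : P != 0 by rewrite expf_neq0// natr_neq0// prime_gt0.
have aP : pabs P = p%:R^-1 ^+ m by rewrite /P pabsX abs_p.
have aP0 : 0 < p%:R^-1 ^+ m :> R by rewrite exprn_gt0// abs_p_gt0.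
pose v : K := (padicInt_val x - z%:~R) / P.
suff Zv : v \in padicZ_pred K.
  exists (PadicInt Zv); apply: (val_inj : injective (@padicInt_val R K)).
  rewrite padicInt_valB padicInt_valM padicInt_valX padicInt_val_nat.
  by rewrite padicInt_val_int/= mulrC divfK.
rewrite !inE; apply/padicZP => e e0.
have /padicZP Zx : padicZ (x : K) by have := padicInt_valP x; rewrite !inE.
(* The bound 1 makes [p^m] divide [w - z]; the bound [e] survives the division by [p^m]. *)
have e1 : 0 < Num.min e 1 * p%:R^-1 ^+ m by rewrite mulr_gt0// lt_min e0 ltr01.
have [w xw] := Zx _ e1.
have xwm : pabs (padicInt_val x - w%:~R) <= p%:R^-1 ^+ m.
  by rewrite (le_trans (ltW xw))// ger_pMl// ge_min lexx orbT.
have : (p ^ m %| `|w - z|%N)%N.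
  apply: pabs_le_dvdn; rewrite -pabs_absz rmorphB/=.
  rewrite (_ : _ - _ = (padicInt_val x - z%:~R) - (padicInt_val x - w%:~R));
    last by ring.
  by rewrite (le_trans (pabsD _ _))// pabsN ge_max xz xwm.
have -> : (p ^ m = `|(p ^ m)%:Z|)%N by [].
rewrite -dvdzE => /dvdzP[k wk].
exists k; rewrite -(ltr_pM2r aP0) -{1}aP -pabsM mulrBl divfK//.
rewrite (_ : k%:~R * P = (w - z)%:~R); last first.
  by rewrite wk rmorphM/= /P -natrX -pmulrn.
rewrite rmorphB/= opprB addrA subrK.
by rewrite (lt_le_trans xw)// ler_pM2r// ge_min lexx.
Qed.

Lemma padic_exponents_neq0 q x : Tp p q -> padic_exponents p q x !=set0.
Proof.
move=> [m _ qm].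
have /padicZP Zx : padicZ (x : K) by have := padicInt_valP x; rewrite !inE.
have [z xz] := Zx _ (exprn_gt0 m abs_p_gt0).
by exists z, m => //; apply: padicInt_quotient; rewrite ltW.
Qed.

Lemma Tp_neq0 q : Tp p q -> q != 0.
Proof.
move=> [m _]; apply: contra_eqN => /eqP ->.
by rewrite expr0n expn_eq0 eqn0Ngt prime_gt0// eq_sym oner_eq0.
Qed.

Lemma pabs_padicInt_quotient x (z : int) m k : (k <= m)%N ->
  (exists u : padicInt K, x - z%:~R = p%:R ^+ m * u) ->
  pabs (padicInt_val x - z%:~R) <= p%:R^-1 ^+ k.
Proof.
move=> km [u /(congr1 (@padicInt_val R K))].
rewrite padicInt_valB padicInt_valM padicInt_valX padicInt_val_nat.
rewrite padicInt_val_int => ->; rewrite pabsM pabsX abs_p.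
rewrite (le_trans (ler_wpM2l _ (pabs_padicInt u))) ?mulr1 ?exprn_ge0
  ?(ltW abs_p_gt0)//.
by rewrite ler_wiXn2l// ltW ?abs_p_gt0 ?abs_p_lt1.
Qed.

Lemma padic_powE q x z : Tp p q -> padic_exponents p q x z ->
  padic_pow p q x = q ^ z.
Proof.
move=> qT [m qm xz]; rewrite /padic_pow.
have /(xgetPex 0)[m0 qm0] := padic_exponents_neq0 x qT.
set z0 := xget _ _ => xz0.
(* Both exponents agree with [x] modulo [p^k], and [q^(p^k) = 1] since [k] is one of [m] and
   [m0]. *)
pose k := minn m m0.
have qk : q ^+ (p ^ k) = 1 by rewrite /k; case: leqP.
have le1 := pabs_padicInt_quotient (geq_minl m m0 : (k <= m)%N) xz.
have le2 := pabs_padicInt_quotient (geq_minr m m0 : (k <= m0)%N) xz0.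
have : (p ^ k %| `|z0 - z|%N)%N.
  apply: pabs_le_dvdn; rewrite -pabs_absz rmorphB/=.
  rewrite (_ : _ - _ = (padicInt_val x - z%:~R) - (padicInt_val x - z0%:~R));
    last by ring.
  by rewrite (le_trans (pabsD _ _))// pabsN ge_max le1 le2.
have -> : (p ^ k = `|(p ^ k)%:Z|)%N by [].
rewrite -dvdzE => /dvdzP[d zd].
rewrite -(subrK z z0) expfzDr ?Tp_neq0// zd [d * _]mulrC -exprz_exp -exprnP qk.
by rewrite exp1rz mul1r.
Qed.

Lemma padic_powD_nat q x k : Tp p q ->
  padic_pow p q (x + k%:R) = q ^+ k * padic_pow p q x.
Proof.
move=> qT; have [z xz] := padic_exponents_neq0 x qT.
rewrite (padic_powE qT xz) (@padic_powE _ _ (k%:Z + z)) ?expfzDr ?Tp_neq0//.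
case: xz => m qm [u xu]; exists m => //; exists u.
by rewrite -xu rmorphD/= opprD addrA -pmulrn addrK.
Qed.

Lemma padic_pow_nat q k : Tp p q -> padic_pow p q k%:R = q ^+ k.
Proof.
move=> qT; rewrite -[k%:R]add0r padic_powD_nat// (@padic_powE _ _ 0) ?mulr1//.
by case: qT => m _ qm; exists m => //; exists 0; rewrite subrr mulr0.
Qed.

End PadicIntegers.

(** * Fermionic integrals of [q^z z^n] *)

Section Integration.
Variables (p : nat) (R : realType) (K : ultrametricField R) (q : K).
Hypothesis p_prime : prime p.
Hypothesis p_odd : odd p.
Hypothesis abs_p : pabs (p%:R : K) = p%:R^-1.
Hypothesis qT : Tp p q.
Implicit Types (x y z : padicInt K).

Let natr_neq0 := natr_neq0 p_prime abs_p.

Let fact_neq0 n : n`!%:R != 0 :> K.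
Proof. by rewrite natr_neq0// fact_gt0. Qed.

Lemma cvg_pabs_expn : (fun N => (p ^ N)%:R : K) @ \oo --> (0 : K).
Proof.
apply/cvg_pabsP => e e0.
have a1 : `|p%:R^-1 : R| < 1.
  by rewrite ger0_norm ?abs_p_lt1// ltW ?abs_p_gt0.
have /cvgr0Pnorm_lt small := cvg_expr a1.
apply: filterS (small e e0) => N; rewrite sub0r pabsN natrX pabsX abs_p.
exact/le_lt_trans/ler_norm.
Qed.

Lemma Tp_expn_near : \forall N \near \oo, q ^+ (p ^ N) = 1.
Proof.
case: qT => m _ qm; exists m => // N /= mN.
by rewrite -(subnKC mN) expnD exprM qm expr1n.
Qed.

Definition twisted_monomial n z : K := padic_pow p q z * padicInt_val z ^+ n.
Local Notation g := twisted_monomial.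

(** For exponential generating series in [n], the shift by [k] is multiplication by
    [q^k e^(k t)]. *)
Lemma twisted_monomialD_nat n z k :
  g n (z + k%:R)
  = q ^+ k * \sum_(j < n.+1) 'C(n, j)%:R * (k%:R ^+ (n - j) * g j z).
Proof.
rewrite /g padic_powD_nat// padicInt_valD padicInt_val_nat addrC exprDn -mulrA.
congr (_ * _); rewrite mulr_sumr; apply: eq_bigr => j _.
by rewrite -mulr_natl; ring.
Qed.

Lemma twisted_monomial_nat n k : g n k%:R = q ^+ k * k%:R ^+ n.
Proof. by rewrite /g padic_pow_nat// padicInt_val_nat. Qed.

(** Once [q^(p^N) = 1], the shift by [p^N] leaves the power of [q] unchanged and only the polynomial
    factor varies. *)
Lemma cvg_twisted_monomial n y :
  (fun N => g n (y + (p ^ N)%:R)) @ \oo --> g n y.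
Proof.
have H : (fun N => padic_pow p q y * (padicInt_val y + (p ^ N)%:R) ^+ n) @ \oo
    --> g n y.
  apply: cvg_pabsZ; apply: cvg_pabsX; rewrite -[X in _ --> X]addr0.
  by apply: cvg_pabsD; [exact: cvg_cst|exact: cvg_pabs_expn].
apply: cvg_trans H; apply: near_eq_cvg.
apply: filterS Tp_expn_near => N qN.
by rewrite /g padic_powD_nat// qN mul1r padicInt_valD padicInt_val_nat.
Qed.

Local Notation F n y := (fermionic_sum p (fun x => g n (x + y))).

Lemma fermionic_sumD_nat n y k N :
  F n (y + k%:R) N
  = q ^+ k * \sum_(j < n.+1) 'C(n, j)%:R * (k%:R ^+ (n - j) * F j y N).
Proof.
rewrite /fermionic_sum; under eq_bigr => x _ do
  rewrite addrA twisted_monomialD_nat -mulrA mulr_suml.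
rewrite -mulr_sumr exchange_big/=; congr (_ * _); apply: eq_bigr => j _.
by rewrite !mulr_sumr; apply: eq_bigr => x _; rewrite !mulrA.
Qed.

(* The telescoping of [h (x + 1) + h x] against [(-1)^x] leaves [h (p^N) + h 0],
   as [p^N] is odd. *)
Lemma fermionic_sum_rec n y N :
  F n (y + 1) N + F n y N = g n (y + (p ^ N)%:R) + g n y.
Proof.
rewrite /fermionic_sum -big_split/=.
pose h k := - (g n (k%:R + y) * (-1) ^+ k).
transitivity (\sum_(0 <= k < p ^ N) (h k.+1 - h k)).
  rewrite big_mkord; apply: eq_bigr => k _; rewrite /h -natr1 exprS opprK.
  by rewrite [y + 1]addrC addrA mulN1r mulrN opprK.
rewrite telescope_sumr// /h -signr_odd oddX p_odd orbT expr1 mulrN1 expr0.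
by rewrite mulr1 !opprK add0r [X in g n X + _]addrC.
Qed.

Lemma natr2_neq0 : 2 != 0 :> K. Proof. exact: natr_neq0. Qed.

(** As [p^m] is odd, [q = -1] would give [-1 = q^(p^m) = 1]. This is the constant term of
    [q e^t + 1]. *)
Lemma Tp_add1_neq0 : q + 1 != 0.
Proof.
rewrite addr_eq0; apply/eqP => qN1.
have [m _] := qT; rewrite qN1 -signr_odd oddX p_odd orbT expr1 => /esym/eqP.
by rewrite -addr_eq0 (negbTE natr2_neq0).
Qed.

Lemma is_cvg_fermionic_sum n y : cvg (F n y @ \oo).
Proof.
pose b k := q * fps_exp K k + 1 * fps_one K k.
pose u N k := F k y N / k`!%:R.
have b0 : b 0%N != 0.
  by rewrite /b /fps_exp /fps_one /= fact0 invr1 !mulr1 Tp_add1_neq0.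
(* The sum [F k (y + 1) + F k y] is computed twice: by expanding the shift and by telescoping. *)
have bu N k : fps_mul b (u N) k
    = k`!%:R^-1 * (g k (y + (p ^ N)%:R) + g k y).
  apply: (mulfI (fact_neq0 k)); rewrite mulVKf// fps_mul_exp// mul1r.
  rewrite -fermionic_sum_rec (fermionic_sumD_nat _ _ 1) expr1.
  by under [in RHS]eq_bigr => j _ do rewrite expr1n mul1r.
have cu : forall k, cvg ((fun N => u N k) @ \oo).
  apply: (is_cvg_fps_mul b0) => // k; under eq_fun => N do rewrite bu.
  apply: cvgP; apply: cvg_pabsZ.
  by apply: cvg_pabsD; [exact: cvg_twisted_monomial|exact: cvg_cst].
rewrite (_ : F n y = fun N => n`!%:R * u N n).
  by apply: cvgP; apply: cvg_pabsZ; exact: cu.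
by apply/funext => N; rewrite mulrC divfK.
Qed.

(** This is [q^y] times the Euler polynomial with generating series [2 e^(y t) / (q e^t + 1)]. *)
Definition twisted_euler n y : K :=
  fermionic_integral p (fun x => g n (x + y)).
Local Notation G := twisted_euler.

Lemma cvg_twisted_euler n y : F n y @ \oo --> G n y.
Proof. exact: is_cvg_fermionic_sum. Qed.

Lemma twisted_eulerD_nat n y k :
  G n (y + k%:R)
  = q ^+ k * \sum_(j < n.+1) 'C(n, j)%:R * (k%:R ^+ (n - j) * G j y).
Proof.
apply: (cvg_pabs_uniq (@cvg_twisted_euler n (y + k%:R))).
rewrite (funext (fermionic_sumD_nat n y k)).
apply: cvg_pabsZ; apply: (@cvg_pabs_sum _ _ _ _
  (fun (j : 'I_n.+1) N => 'C(n, j)%:R * (k%:R ^+ (n - j) * F j y N))) => j.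
by apply: cvg_pabsZ; apply: cvg_pabsZ; exact: cvg_twisted_euler.
Qed.

Lemma twisted_euler_rec n y : G n (y + 1) + G n y = 2 * g n y.
Proof.
apply: (cvg_pabs_uniq (cvg_pabsD (@cvg_twisted_euler n (y + 1))
  (@cvg_twisted_euler n y))).
rewrite (funext (fermionic_sum_rec n y)).
rewrite mulr_natl mulr2n.
by apply: cvg_pabsD; [exact: cvg_twisted_monomial|exact: cvg_cst].
Qed.

(** * Bosonic sums and the q-Bernoulli numbers *)

Local Notation T n := (bosonic_sum p (G n)).

Lemma bosonic_sum_rec n N : q ^+ (p ^ N) = 1 ->
  q ^+ 2 * (\sum_(j < n.+1) 'C(n, j)%:R * (2 ^+ (n - j) * T j N)) - T n N
  = (p ^ N)%:R^-1 * (2 * ((p ^ N)%:R ^+ n - 0 ^+ n)).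
Proof.
move=> qN; transitivity ((p ^ N)%:R^-1
    * \sum_(y < p ^ N) (G n (y%:R + 2%:R) - G n y%:R)).
  rewrite /bosonic_sum sumrB mulrBr; congr (_ - _).
  under [in RHS]eq_bigr => y _ do rewrite twisted_eulerD_nat.
  rewrite -mulr_sumr exchange_big/= mulrCA; congr (_ * _).
  rewrite mulr_sumr; apply: eq_bigr => j _.
  rewrite !mulr_sumr; apply: eq_bigr => y _; ring.
congr (_ * _); rewrite -(big_mkord xpredT
  (fun k => G n (k%:R + 2%:R) - G n k%:R)).
rewrite (eq_bigr (fun k => 2 * g n k.+1%:R - 2 * g n k%:R)) => [|k _].
  (* The endpoint [p^N] contributes [(p^N)^n] because [q^(p^N) = 1]; the endpoint 0 contributes
     [0^n], which is 1 for [n = 0]. *)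
  rewrite (telescope_sumr (fun k => 2 * g n k%:R))// !twisted_monomial_nat.
  by rewrite qN expr0 !mul1r mulrBr.
rewrite -natrD addn2 -!twisted_euler_rec !natr1; ring.
Qed.

Let bern k := q ^+ 2 * fps_exp K k - fps_one K k.

(** The constant term is [q^2 - 1]; if it vanishes, the coefficient [q^2] of [t] does not. *)
Lemma bern_order :
  exists2 s, bern s != 0 & forall i, (i < s)%N -> bern i = 0.
Proof.
have q20 : q ^+ 2 != 0 by rewrite expf_neq0// (Tp_neq0 p_prime qT).
have [b0|b0] := eqVneq (bern 0) 0; last by exists 0%N.
exists 1%N; last by case.
by rewrite /bern /fps_exp /fps_one/= subr0 invr1 mulr1.
Qed.

(** Dividing by [2^k] substitutes [t / 2] for [t], so that the shift by 2 acts as [q^2 e^t]. *)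
Let u N k := T k N / 2 ^+ k / k`!%:R.

Lemma cvg_bern_mul n :
  (fun N => fps_mul bern (u N) n) @ \oo --> fps_t K n.
Proof.
have H : (fun N => n`!%:R^-1 * ((2 ^+ n)^-1 * (2 *
   ((p ^ N)%:R^-1 * ((p ^ N)%:R ^+ n - 0 ^+ n))))) @ \oo --> fps_t K n.
  case: n => [|n].
    under eq_fun => N do rewrite !expr0 subrr !mulr0; exact: cvg_cst.
  under eq_fun => N do rewrite expr0n/= subr0 [(p ^ N)%:R ^+ _]exprS
    mulKf ?natr_neq0 ?expn_gt0 ?prime_gt0//.
  (* After division by [p^N], [(p^N)^n] remains, with limit [0^n]: nonzero only in degree 1, where
     the factors 2 cancel. *)
  have -> : fps_t K n.+1 = n.+1`!%:R^-1 * ((2 ^+ n.+1)^-1 * (2 * 0 ^+ n)).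
    rewrite /fps_t; case: n => [|n].
      by rewrite /= expr0 mulr1 expr1 mulVf ?natr2_neq0// invr1 mulr1.
    by rewrite expr0n/= !mulr0.
  by do 3 apply: cvg_pabsZ; apply: cvg_pabsX; exact: cvg_pabs_expn.
apply: cvg_trans H; apply: near_eq_cvg.
apply: filterS Tp_expn_near => N qN; apply: (mulfI (fact_neq0 n)).
rewrite mulVKf// [bern](_ : _ =
  fun k => q ^+ 2 * fps_exp K k + -1 * fps_one K k); last by apply/funext => k; rewrite mulN1r.
rewrite fps_mul_exp// mulN1r; apply: (@mulfI _ (2 ^+ n)).
  by rewrite expf_neq0 ?natr2_neq0.
rewrite mulVKf ?expf_neq0 ?natr2_neq0//.
rewrite [2 * _]mulrCA -bosonic_sum_rec// mulrBr [X in _ = _ - X]mulrC.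
rewrite divfK ?expf_neq0 ?natr2_neq0// mulrCA; congr (_ * _ - _).
rewrite mulr_sumr; apply: eq_bigr => j _; rewrite [RHS]mulrCA; congr (_ * _).
have jn : (j <= n)%N by rewrite -ltnS.
rewrite -[in 2 ^+ n](subnK jn) exprD -mulrA; congr (_ * _).
by rewrite mulrC divfK ?expf_neq0 ?natr2_neq0.
Qed.

Lemma is_cvg_scaled_bosonic_sum k : cvg ((fun N => u N k) @ \oo).
Proof.
have [s bs b0] := bern_order.
by apply: (is_cvg_fps_mul bs b0) => n; apply: cvgP; exact: cvg_bern_mul.
Qed.

Lemma is_cvg_bosonic_sum n : cvg (T n @ \oo).
Proof.
rewrite (_ : T n = fun N => (n`!%:R * 2 ^+ n) * u N n).
  by apply: cvgP; apply: cvg_pabsZ; exact: is_cvg_scaled_bosonic_sum.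
apply/funext => N; rewrite /u mulrC mulrA divfK// divfK//.
by rewrite expf_neq0 ?natr2_neq0.
Qed.

Lemma qBernoulli_bosonic_integral n :
  (2 ^+ n)^-1 * bosonic_integral p (G n) = qBernoulli (q ^+ 2) n.
Proof.
pose c k := bosonic_integral p (G k) / 2 ^+ k / k`!%:R.
have uc k : (fun N => u N k) @ \oo --> c k.
  rewrite /u /c -mulrA [X in _ --> X]mulrC.
  under eq_fun => N do rewrite -mulrA mulrC.
  by apply: cvg_pabsZ; exact: is_cvg_bosonic_sum.
have bc : fps_mul bern c = fps_t K.
  (* Each coefficient of a product is a finite sum, so it passes to the limit in [N]. *)
  apply/funext => k; apply: (fun h => cvg_pabs_uniq h (@cvg_bern_mul k)).
  apply: (@cvg_pabs_sum _ _ _ _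
    (fun (i : 'I_k.+1) N => bern i * u N (k - i)%N)) => i.
  by apply: cvg_pabsZ; exact: uc.
have [s bs b0] := bern_order.
(* Since [c] is a quotient and multiplication by [bern] is injective, [xget] returns [c] and not its
   default 0. *)
have divE : fps_div (fps_t K) bern = c.
  apply: xget_subset1 => // d e /= <- ed.
  exact: (fps_mul_inj bs b0).
by rewrite /qBernoulli divE /c [RHS]mulrC divfK// mulrC.
Qed.

End Integration.

Theorem theorem6 (p : nat) (p_prime : prime p) (p_odd : odd p)
    (R : realType) (K : ultrametricField R) (K_Cp : is_padic_complex p K)
    (q : K) (qT : Tp p q) (n : nat) :
  let integrand := fun y x : padicInt K =>
    padic_pow p q (x + y) * padicInt_val (x + y) ^+ n in
  let inner := fun y : padicInt K => fermionic_integral p (integrand y) in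
  [/\ (forall y : padicInt K, fermionic_integrable p (integrand y)),
      bosonic_integrable p inner &
      (2 ^+ n)^-1 * bosonic_integral p inner = qBernoulli (q ^+ 2) n].
Proof.
have abs_p := padic_abs_p K_Cp.
move=> integrand inner; split=> [y||].
- exact: is_cvg_fermionic_sum.
- exact: is_cvg_bosonic_sum.
- exact: qBernoulli_bosonic_integral.
Qed.
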